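(* Let $m,n\in\mathbb N$. Let $\emptyset\ne\mathcal G\subseteq2^{[m]}$ and $\emptyset\ne\mathcal H\subseteq2^{[n]}$ be hereditary and compressed. For each $\mathcal F\in\{\mathcal G,\mathcal H\}$ let $w_{\mathcal F}\colon\mathcal F\to\mathbb R^+$ satisfy (a) $w_{\mathcal F}(A)\ge2w_{\mathcal F}(B)$ for every $A,B\in\mathcal F$ with $A\subsetneq B$, and (b) $w_{\mathcal F}(\delta_{i,j}(C))\ge w_{\mathcal F}(C)$ for every $C\in\mathcal F$ and every $i,j\in[\max\{m,n\}]$ with $i<j$. Let $g=w_{\mathcal G}$ and $h=w_{\mathcal H}$. If $\mathcal A\subseteq\mathcal G$ and $\mathcal B\subseteq\mathcal H$ are cross-intersecting, then \[g^{(\mathcal G)}(\mathcal A)\,h^{(\mathcal H)}(\mathcal B)\le g^{(\mathcal G)}(\mathcal G(1))\,h^{(\mathcal H)}(\mathcal H(1)).\] Moreover, equality holds if and only if $\mathcal A=\mathcal G(a)$ and $\mathcal B=\mathcal H(a)$ for some $a\in[m]\cap[n]$ such that $g^{(\mathcal G)}(\mathcal G(a))=g^{(\mathcal G)}(\mathcal G(1))$ and $h^{(\mathcal H)}(\mathcal H(a))=h^{(\mathcal H)}(\mathcal H(1))$.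
   Context: $\mathbb R^+$ is the set of positive reals. For a family $\mathcal F$, a function $w\colon\mathcal F\to\mathbb R^+$, and $\mathcal A\subseteq\mathcal F$, $w^{(\mathcal F)}(\mathcal A)=\sum_{A\in\mathcal A}w(A)$ (which is $0$ if $\mathcal A=\emptyset$). For a family $\mathcal F$ of sets and an element $x$, $\mathcal F(x)=\{F\in\mathcal F\colon x\in F\}$. A family is hereditary if it contains all subsets of each of its members. Families $\mathcal A,\mathcal B$ are cross-intersecting if every set of $\mathcal A$ intersects every set of $\mathcal B$. For $i,j$, $\delta_{i,j}(A)=(A\setminus\{j\})\cup\{i\}$ if $j\in A$ and $i\notin A$, and $\delta_{i,j}(A)=A$ otherwise. A family $\mathcal F\subseteq2^{[n]}$ is compressed if $(F\setminus\{j\})\cup\{i\}\in\mathcal F$ whenever $1\le i<j$, $j\in F\in\mathcal F$ and $i\in[n]\setminus F$.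
   Formalization: The ''only if'' half of the equality claim is stated for G ≠ {∅} and H ≠ {∅}; otherwise it fails (G = {∅}, A = {∅}, B = ∅ gives 0 = 0 but A ≠ G(a)). The inequality and the ''if'' half are stated in full. *)

(* Defs.v *)
From mathcomp Require Import all_boot all_order all_algebra finmap reals.

Set Implicit Arguments.
Unset Strict Implicit.
Unset Printing Implicit Defensive.

Import Order.TTheory GRing.Theory Num.Theory.

Local Open Scope fset_scope.
Local Open Scope nat_scope.

Notation family := {fset {fset nat}}.

(* [n] = {1, ..., n} *)
Definition segment (n : nat) : {fset nat} := [fset i in iota 1 n].

Definition hereditary (F : family) : Prop :=
  forall A B : {fset nat}, B \in F -> A `<=` B -> A \in F.

Definition compressed (n : nat) (F : family) : Prop :=
  forall (i j : nat) (A : {fset nat}),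
    1 <= i < j -> A \in F -> j \in A -> i \in segment n `\` A ->
    (A `\ j) `|` [fset i] \in F.

Definition delta (i j : nat) (A : {fset nat}) : {fset nat} :=
  if (j \in A) && (i \notin A) then (A `\ j) `|` [fset i] else A.

Definition star (F : family) (x : nat) : family := [fset A in F | x \in A].

Definition cross_intersecting (A B : family) : Prop :=
  forall X Y : {fset nat}, X \in A -> Y \in B -> X `&` Y != fset0.

Local Open Scope ring_scope.

Definition weight (R : realType) (w : {fset nat} -> R) (A : family) : R :=
  \sum_(X <- A) w X.

(* A weight F -> R^+ is encoded as a total function on {fset nat} of which only
   the values on F are constrained; N stands for max{m, n}. *)
Definition admissible (R : realType) (N : nat) (F : family)
    (w : {fset nat} -> R) : Prop :=
  [/\ forall A, A \in F -> 0 < w A,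
      forall A B, A \in F -> B \in F -> A `<` B -> w A >= 2 * w B
    & forall C i j, C \in F -> i \in segment N -> j \in segment N ->
        (i < j)%N -> w (delta i j C) >= w C].

(* Main.v *)
(** Shifting both families by [delta i j] keeps them cross-intersecting, does
    not decrease their weights, and a singleton common to the shifted families
    comes from a common singleton of the original ones.  So let [A] and [B] be
    stable under all shifts, and let [N] be the largest element.  If [X] in [A]
    and [Y] in [B] meet only in [N], stability forces [X] and [Y] to cover
    [1, N], so each determines the other; one may then trade [X] for [Y \ N]
    (moving it to the other family), or [Y] for [X \ N].  As removing an element
    at least doubles the weight, one of the two trades strictly increases the
    product.  If there is no such pair, deleting [N] from all the sets keeps the
    families cross-intersecting, and induction on [N] applies with the weights
    [g Y + g (Y + N)].  In case of equality a common singleton [{a}] survives,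
    which confines the families to the stars of [a]. *)

Require Import Defs.
From mathcomp Require Import all_boot all_order all_algebra finmap boolp reals.
From mathcomp Require Import zify lra.

Set Implicit Arguments.
Unset Strict Implicit.
Unset Printing Implicit Defensive.

Import Order.TTheory GRing.Theory Num.Theory.

Local Open Scope fset_scope.
Local Open Scope ring_scope.

Local Notation setfam := {fset {fset nat}}.

(** * Segments, stars and cross-intersection *)

Lemma mem_segment (N i : nat) : (i \in segment N) = (0 < i <= N)%N.
Proof. by rewrite in_fset /= mem_iota add1n ltnS. Qed.

Lemma in_star (F : setfam) (x : nat) (X : {fset nat}) :
  (X \in star F x) = (X \in F) && (x \in X).
Proof. by rewrite !inE. Qed.

Lemma star_sub (F : setfam) (x : nat) : star F x `<=` F.
Proof. by apply/fsubsetP => X; rewrite in_star => /andP[]. Qed.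

Lemma cross_intersecting_sym (A B : setfam) :
  cross_intersecting A B -> cross_intersecting B A.
Proof. by move=> AB X Y XB YA; rewrite fsetIC; exact: AB. Qed.

(** * Shifting sets and families *)

Section Delta.
Variables (i j : nat).
Hypothesis ij : i != j.
Implicit Types (X Y : {fset nat}).

Lemma in_delta X z :
  (z \in delta i j X) = if (j \in X) && (i \notin X)
                        then (z != j) && (z \in X) || (z == i) else z \in X.
Proof. by rewrite /delta; case: ifP => _; rewrite ?inE. Qed.

Lemma delta_id X : delta i j X = X -> (j \in X) && (i \notin X) = false.
Proof.
case: (boolP (_ && _)) => // h /fsetP/(_ i); rewrite in_delta h eqxx orbT.
by case/andP: h => _ /negPf ->.
Qed.

Lemma delta_moved X : delta i j X != X -> (j \in X) /\ (i \notin X).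
Proof. by rewrite /delta; case: ifP => [/andP[]|] //; rewrite eqxx. Qed.

Lemma delta_moved_inj X Y : delta i j X != X -> delta i j Y != Y ->
  delta i j X = delta i j Y -> X = Y.
Proof.
move=> /delta_moved[jX iX] /delta_moved[jY iY] /fsetP e; apply/fsetP => z.
have := e z; rewrite !in_delta jX iX jY iY /=.
have [-> _|zj] := eqVneq z j; first by rewrite jX jY.
have [->|zi] := eqVneq z i; first by rewrite (negPf iX) (negPf iY).
by rewrite /= !orbF.
Qed.

Lemma delta_eq1 X a : delta i j X = [fset a] -> exists x, X = [fset x].
Proof.
have [->|/delta_moved[jX iX]] := eqVneq (delta i j X) X; first by exists a.
move=> /fsetP e; exists j; apply/fsetP => z; rewrite inE.
have ai : a = i.
  by have := e i; rewrite in_delta jX iX eqxx orbT inE => /esym/eqP.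
have := e z; rewrite in_delta jX iX inE ai /=.
have [->|zj] := eqVneq z j; first by rewrite jX.
have [->|zi] := eqVneq z i; first by rewrite (negPf iX).
by rewrite orbF.
Qed.

(** A set moves only when its image is not already in [A]; this makes the map injective on [A], so
    that no weight is lost by collisions. *)
Definition shift_set (A : setfam) X : {fset nat} :=
  if delta i j X \in A then X else delta i j X.

Definition shift (A : setfam) : setfam := [fset shift_set A X | X in A].

Lemma shift_set_inj A : {in A &, injective (shift_set A)}.
Proof.
move=> X Y XA YA; rewrite /shift_set.
case: ifPn => dX; case: ifPn => dY // e; first by rewrite -e XA in dY.
  by rewrite e YA in dX.
apply: delta_moved_inj e.
  by apply: contraNneq dX => ->.
by apply: contraNneq dY => ->.
Qed.

Lemma shift_set1 A a : [fset a] \in shift A -> exists x, [fset x] \in A.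
Proof.
case/imfsetP => X /= XA; rewrite /shift_set; case: ifP => _.
  by move=> e; exists a; rewrite e.
by move/esym/delta_eq1 => [x e]; exists x; rewrite -e.
Qed.

(** The delicate case has [j] but not [i] in [Y]: then [Y] stayed put because [delta i j Y] is
    already in [B], and a point that [X] shares with that set is neither [i] nor [j], so it lies in
    [Y] and survives in [delta i j X]. *)
Lemma shift_cross_fixed X Y (B : setfam) :
    j \in X -> i \notin X -> Y \in B -> shift_set B Y = Y ->
    (forall Z, Z \in B -> X `&` Z != fset0) ->
  delta i j X `&` Y != fset0.
Proof.
move=> jX iX YB sY cX; apply/fset0Pn.
have [iY|iY] := boolP (i \in Y).
  by exists i; rewrite !inE in_delta jX iX eqxx orbT.
have [jY|jY] := boolP (j \in Y).
  have dB : delta i j Y \in B.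
    by move: sY; rewrite /shift_set; case: ifP => // _ /delta_id; rewrite jY iY.
  have /fset0Pn[z] := cX _ dB; rewrite inE in_delta jY iY /=.
  case/andP => zX /orP[/andP[zj zY]|/eqP zi]; last by rewrite -zi zX in iX.
  by exists z; rewrite inE in_delta jX iX zj zX zY.
have /fset0Pn[z] := cX _ YB; rewrite inE => /andP[zX zY].
exists z; rewrite inE in_delta jX iX zX zY /= andbT.
by rewrite (contraNneq _ jY) // => <-.
Qed.

Lemma shift_cross (A B : setfam) :
  cross_intersecting A B -> cross_intersecting (shift A) (shift B).
Proof.
move=> AB _ _ /imfsetP[X /= XA ->] /imfsetP[Y /= YB ->].
have fixed_or (C : setfam) Z : Z \in C ->
    shift_set C Z = Z \/ [/\ j \in Z, i \notin Z & shift_set C Z = delta i j Z].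
  move=> ZC; rewrite /shift_set; case: ifPn => dC; first by left.
  right; case: (@delta_moved Z) => //.
  by apply: contraNneq dC => ->.
have [eX|[jX iX eX]] := fixed_or _ _ XA;
  have [eY|[jY iY eY]] := fixed_or _ _ YB.
- by rewrite eX eY; exact: AB.
- rewrite eX eY fsetIC; apply: (shift_cross_fixed jY iY XA eX) => Z ZA.
  by rewrite fsetIC; exact: AB.
- by rewrite eX eY; apply: (shift_cross_fixed jX iX YB eY) => Z ZB; exact: AB.
- rewrite eX eY; apply/fset0Pn; exists i.
  by rewrite inE !in_delta jX iX jY iY eqxx !orbT.
Qed.

End Delta.

Lemma weight_shift (R : realType) (i j : nat) (w : {fset nat} -> R)
    (A : setfam) :
    i != j -> (forall X, X \in A -> w X <= w (delta i j X)) ->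
  weight w A <= weight w (shift i j A).
Proof.
move=> ij wd; rewrite /weight /shift big_imfset /=; last exact: shift_set_inj.
rewrite [X in X <= _]big_seq [X in _ <= X]big_seq; apply: ler_sum => X XA.
by rewrite /shift_set; case: ifP => // _; exact: wd.
Qed.

(** * A measure of progress *)

(* Powers of two are used so that removing one set containing [N] outweighs
   adding any subset of [1, N - 1]. *)
Definition code (X : {fset nat}) : nat := (\sum_(x <- X) 2 ^ x)%N.

(** The total mass of the two families drops under every shift that moves a set and under every
    trade, so it serves as termination measure. *)
Definition mass (A : setfam) : nat := (\sum_(X <- A) code X)%N.

Lemma code_lt (N : nat) (X : {fset nat}) :
  X `<=` segment N -> (code X < 2 ^ N.+1)%N.
Proof.
elim: N X => [|N IH] X XN.
  rewrite /code big1_fset // => x /(fsubsetP XN); rewrite mem_segment; lia.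
have sub : X `\ N.+1 `<=` segment N.
  apply/fsubsetP => x; rewrite in_fsetD1 => /andP[xN /(fsubsetP XN)].
  by rewrite !mem_segment [(x <= N.+1)%N]leq_eqVlt (negPf xN).
have lt := IH _ sub.
have [NX|NX] := boolP (N.+1 \in X).
  by rewrite /code (big_fsetD1 N.+1) //= [(2 ^ N.+2)%N]expnS mul2n -addnn
             ltn_add2l.
by rewrite -(mem_fsetD1 NX) (leq_trans lt) // leq_exp2l.
Qed.

Lemma code_delta (i j : nat) (X : {fset nat}) :
  (i < j)%N -> delta i j X != X -> (code (delta i j X) < code X)%N.
Proof.
move=> ij /delta_moved[jX iX]; rewrite /delta jX iX /= fsetUC /code.
rewrite big_fsetU1 /=; last by rewrite !inE (negPf iX) andbF.
by rewrite [X in (_ < X)%N](big_fsetD1 j) //= ltn_add2r ltn_exp2l.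
Qed.

Lemma code_shift_set (i j : nat) (A : setfam) (X : {fset nat}) :
  (i < j)%N -> (code (shift_set i j A X) <= code X)%N.
Proof.
move=> ij; rewrite /shift_set; case: ifP => // _.
by have [->//|/(code_delta ij)/ltnW] := eqVneq (delta i j X) X.
Qed.

Lemma massE_shift (i j : nat) (A : setfam) : (i < j)%N ->
  mass (shift i j A) = (\sum_(X <- A) code (shift_set i j A X))%N.
Proof.
move=> ij; rewrite /mass /shift big_imfset //=.
by apply: shift_set_inj; rewrite ltn_eqF.
Qed.

Lemma mass_shift (i j : nat) (A : setfam) :
  (i < j)%N -> (mass (shift i j A) <= mass A)%N.
Proof.
move=> ij; rewrite massE_shift //; apply: leq_sum => X _.
exact: code_shift_set.
Qed.

Lemma mass_shift_lt (i j : nat) (A : setfam) (X : {fset nat}) : (i < j)%N ->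
  X \in A -> delta i j X \notin A -> (mass (shift i j A) < mass A)%N.
Proof.
move=> ij XA dA; rewrite massE_shift // /mass.
rewrite !(big_fsetD1 X XA) /= -addSn; apply: leq_add.
  rewrite /shift_set (negPf dA); apply: code_delta => //.
  by apply: contraNneq dA => ->.
by apply: leq_sum => Y _; exact: code_shift_set.
Qed.

(** * Weights of families *)

Section Weight.
Variables (R : realType) (w : {fset nat} -> R).
Implicit Types (A B : setfam) (X Y Z : {fset nat}).

Lemma weightD A B : A `<=` B -> weight w B = weight w A + weight w (B `\` A).
Proof.
move=> AB; rewrite /weight (big_fsetID _ (mem A)) /=; congr (_ + _).
  congr (\sum_(X <- enum_fset _) _); apply/fsetP => X; rewrite !inE /=.
  by apply/andP/idP => [[]//|XA]; split=> //; exact: (fsubsetP AB).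
congr (\sum_(X <- enum_fset _) _); apply/fsetP => X.
by rewrite !inE /= andbC.
Qed.

Lemma weight_ge0 A : (forall X, X \in A -> 0 < w X) -> 0 <= weight w A.
Proof.
by move=> w0; rewrite /weight big_seq sumr_ge0 // => X XA; exact/ltW/w0.
Qed.

Lemma weight_gt0 A :
  (forall X, X \in A -> 0 < w X) -> A != fset0 -> 0 < weight w A.
Proof.
move=> w0 /fset0Pn[X XA]; rewrite /weight (big_fsetD1 X) //=.
rewrite ltr_pwDl ?w0 //; apply: weight_ge0 => Y; rewrite !inE => /andP[_].
exact: w0.
Qed.

Lemma le_weight A B :
  A `<=` B -> (forall X, X \in B -> 0 < w X) -> weight w A <= weight w B.
Proof.
move=> AB w0; rewrite (weightD AB) lerDl weight_ge0 // => X.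
by rewrite !inE => /andP[_ /w0].
Qed.

Lemma eq_weight_sub A B : A `<=` B -> (forall X, X \in B -> 0 < w X) ->
  weight w A = weight w B -> A = B.
Proof.
move=> AB w0 e; apply/eqP; rewrite eqEfsubset AB -fsetD_eq0 /=.
apply: contra_eqT e => D0; rewrite (weightD AB) lt_eqF // ltrDl weight_gt0 //.
by move=> X; rewrite !inE => /andP[_ /w0].
Qed.

Lemma weight_ge_mem A X :
  (forall Y, Y \in A -> 0 < w Y) -> X \in A -> w X <= weight w A.
Proof.
move=> w0 XA; rewrite /weight (big_fsetD1 X) //= lerDl weight_ge0 // => Y.
by rewrite !inE => /andP[_ /w0].
Qed.

Lemma weight_fset2_le A X Y : (forall Z, Z \in A -> 0 < w Z) ->
  X \in A -> Y \in A -> Y != X -> w X + w Y <= weight w A.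
Proof.
move=> w0 XA YA YX.
have -> : w X + w Y = weight w [fset X; Y].
  by rewrite /weight big_fsetU1 ?inE 1?eq_sym //= big_seq_fset1.
by apply: le_weight => //; apply/fsubsetP => Z; rewrite !inE => /orP[]/eqP->.
Qed.

Lemma weight_fset3_le A X Y Z : (forall T, T \in A -> 0 < w T) ->
  X \in A -> Y \in A -> Z \in A -> uniq [:: X; Y; Z] ->
  w X + w Y + w Z <= weight w A.
Proof.
move=> w0 XA YA ZA /= /and3P[]; rewrite !inE => /norP[XY XZ] YZ _.
rewrite /weight (big_fsetD1 X) //= -addrA lerD2l.
apply: weight_fset2_le; rewrite ?inE ?YA ?ZA ?andbT 1?eq_sym //.
by move=> T; rewrite !inE => /andP[_ /w0].
Qed.

End Weight.

(** * Weighted complexes over a common ground set *)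

(** Requiring the singleton of [1] excludes the empty family and the family of the empty set alone,
    and gives the star of [1] positive weight. *)
Definition weighted_complex (R : realType) (N : nat) (G : setfam)
    (g : {fset nat} -> R) : Prop :=
  [/\ G `<=` fpowerset (segment N), hereditary G, compressed N G,
      admissible N G g & [fset 1%N] \in G].

Section WeightedComplex.
Variables (R : realType) (N : nat) (G : setfam) (g : {fset nat} -> R).
Implicit Types (A : setfam) (X : {fset nat}) (i j z : nat).
Hypothesis Gg : weighted_complex N G g.

Lemma wc_her : hereditary G. Proof. by case: Gg. Qed.

Lemma wc_in1 : [fset 1%N] \in G. Proof. by case: Gg. Qed.

Lemma wc_segment X z : X \in G -> z \in X -> (0 < z <= N)%N.
Proof.
case: Gg => /fsubsetP GN _ _ _ _ /GN; rewrite fpowersetE => /fsubsetP XN /XN.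
by rewrite mem_segment.
Qed.

Lemma wc_gt0 A X : A `<=` G -> X \in A -> 0 < g X.
Proof. by case: Gg => _ _ _ [g0 _ _] _ /fsubsetP AG /AG/g0. Qed.

Lemma wc_double X z : X \in G -> z \in X -> 2 * g X <= g (X `\ z).
Proof.
case: Gg => _ her _ [_ ga _] _ XG zX; apply: ga; rewrite ?fproperD1 //.
exact: her XG (fsubsetDl _ _).
Qed.

Lemma wc_delta i j X : (0 < i < j)%N -> X \in G -> delta i j X \in G.
Proof.
move=> ij XG; have [->//|/delta_moved[jX iX]] := eqVneq (delta i j X) X.
rewrite /delta jX iX /=; case: Gg => _ _ com _ _; apply: com => //.
rewrite in_fsetD iX mem_segment; have := wc_segment XG jX; lia.
Qed.

Lemma wc_delta_weight i j X :
  (0 < i < j)%N -> X \in G -> g X <= g (delta i j X).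
Proof.
move=> ij XG; have [->//|/delta_moved[jX iX]] := eqVneq (delta i j X) X.
have jN := wc_segment XG jX.
by case: Gg => _ _ _ [_ _ gb] _; apply: gb => //; rewrite ?mem_segment; lia.
Qed.

Lemma wc_shift_sub i j A : (0 < i < j)%N -> A `<=` G -> shift i j A `<=` G.
Proof.
move=> ij /fsubsetP AG; apply/fsubsetP => _ /imfsetP[X /= /AG XG ->].
by rewrite /shift_set; case: ifP => // _; exact: wc_delta.
Qed.

Lemma wc_shift_weight i j A : (0 < i < j)%N -> A `<=` G ->
  weight g A <= weight g (shift i j A).
Proof.
move=> ij /fsubsetP AG; apply: weight_shift => [|X /AG XG]; first lia.
exact: wc_delta_weight.
Qed.

(** Shifting the star of [a] towards [1] lands in the star of [1]: a set without [1] has to move,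
    since its image lacks [a] and so is not yet in the star of [a]. *)
Lemma weight_star_le1 a : (0 < a)%N ->
  weight g (star G a) <= weight g (star G 1%N).
Proof.
move=> a0; have [->//|a1] := eqVneq a 1%N.
have a1' : (0 < 1 < a)%N by lia.
apply: (le_trans (wc_shift_weight a1' (star_sub G a))).
apply: le_weight => [|X]; last exact: (wc_gt0 (star_sub _ _)).
apply/fsubsetP => Y YS; rewrite in_star.
rewrite (fsubsetP (wc_shift_sub a1' (star_sub G a)) _ YS) /=.
case/imfsetP: YS => X /= XS ->; rewrite /shift_set.
have /andP[XG aX] : (X \in G) && (a \in X) by rewrite -in_star.
have [oneX|oneX] := boolP (1%N \in X).
  by case: ifP => // _; rewrite in_delta aX oneX.
rewrite in_star !in_delta aX oneX !eqxx (negPf a1) /= andbF.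
by rewrite in_delta aX oneX eqxx orbT.
Qed.

Lemma weight_star1_gt0 : 0 < weight g (star G 1%N).
Proof.
apply: weight_gt0 => [X|]; first exact: (wc_gt0 (star_sub _ _)).
by apply/fset0Pn; exists [fset 1%N]; rewrite in_star wc_in1 inE.
Qed.

End WeightedComplex.

Section Pair.
Variables (R : realType) (N : nat) (G H : setfam) (g h : {fset nat} -> R).
Hypotheses (Gg : weighted_complex N G g) (Hh : weighted_complex N H h).

(** Each factor is at most the weight of its star of [a], hence of its star of [1]. The latter
    weights are positive, so equal products force equality all along both chains. *)
Lemma substar_eq (A B : setfam) a : (0 < a)%N ->
    A `<=` star G a -> B `<=` star H a ->
    weight g A * weight h B = weight g (star G 1%N) * weight h (star H 1%N) ->
  [/\ A = star G a, B = star H a,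
      weight g (star G a) = weight g (star G 1%N)
    & weight h (star H a) = weight h (star H 1%N)].
Proof.
move=> a0 Aa Ba e.
have Ga0 X : X \in star G a -> 0 < g X by exact: (wc_gt0 Gg (star_sub _ _)).
have Ha0 X : X \in star H a -> 0 < h X by exact: (wc_gt0 Hh (star_sub _ _)).
have leA := le_weight Aa Ga0; have leB := le_weight Ba Ha0.
have leG := weight_star_le1 Gg a0; have leH := weight_star_le1 Hh a0.
have G1 := weight_star1_gt0 Gg; have H1 := weight_star1_gt0 Hh.
have A0 : 0 <= weight g A by apply: weight_ge0 => X /(fsubsetP Aa)/Ga0.
have eA : weight g A = weight g (star G 1%N) by nra.
have eB : weight h B = weight h (star H 1%N).
  by move: e; rewrite eA => /(mulfI (lt0r_neq0 G1)).
split; [apply: (eq_weight_sub (w := g)) => //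
       | apply: (eq_weight_sub (w := h)) => // | |]; lra.
Qed.

End Pair.

(** * Trading one set for another *)

Section Alteration.
Variables (R : realType) (N : nat).

Section OneSide.
Variables (G H : setfam) (g h : {fset nat} -> R).
Hypotheses (Gg : weighted_complex N G g) (Hh : weighted_complex N H h).
Variables (A B : setfam).
Hypotheses (AG : A `<=` G) (BH : B `<=` H) (AB : cross_intersecting A B).
Hypothesis stA : forall i j X, (0 < i < j)%N -> X \in A -> delta i j X \in A.
Variables (X Y : {fset nat}).
Hypotheses (XA : X \in A) (YB : Y \in B) (XY : X `&` Y = [fset N]).

(* Otherwise moving [N] to [i] in [X'] makes it disjoint from [Y]. *)
Lemma stable_cover X' i : X' \in A -> X' `&` Y = [fset N] ->
  (0 < i < N)%N -> i \notin X' -> i \in Y.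
Proof.
move=> XA' XY' iN iX; apply/contraT => iY.
have NX : N \in X' by have /fsetP/(_ N) := XY'; rewrite !inE eqxx => /andP[].
have /fset0Pn[z] := AB (stA iN XA') YB; rewrite inE in_delta NX iX /=.
case/andP => /orP[/andP[zN zX] zY|/eqP -> iY']; last by rewrite iY' in iY.
by have /fsetP/(_ z) := XY'; rewrite !inE zX zY (negPf zN).
Qed.

(** Apart from [N], a set of [A] meeting [Y] exactly in [N] avoids [Y] and, by [stable_cover],
    contains all that [Y] misses in [1, N]. *)
Lemma stable_partner_uniq X' : X' \in A -> X' `&` Y = [fset N] -> X' = X.
Proof.
have half X1 X2 z : X1 \in A -> X2 \in A -> X1 `&` Y = [fset N] ->
    X2 `&` Y = [fset N] -> z \in X1 -> z \in X2.
  move=> XA1 XA2 XY1 XY2 zX1.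
  have NX : N \in X2 by have /fsetP/(_ N) := XY2; rewrite !inE eqxx => /andP[].
  have [->//|zN] := eqVneq z N.
  have zY : z \notin Y.
    by have /fsetP/(_ z) := XY1; rewrite !inE zX1 (negPf zN) /= => ->.
  have /andP[z0 zleN] := wc_segment Gg (fsubsetP AG _ XA1) zX1.
  apply: contraNT zY; apply: stable_cover => //.
  by rewrite z0 ltn_neqAle zN.
by move=> XA' XY'; apply/fsetP => z; apply/idP/idP; exact: half.
Qed.

Let NX : N \in X.
Proof. by have /fsetP/(_ N) := XY; rewrite !inE eqxx => /andP[]. Qed.

Let NY : N \in Y.
Proof. by have /fsetP/(_ N) := XY; rewrite !inE eqxx => /andP[]. Qed.

(** Hence [X] is the only obstacle in [A] to adding [Y] without [N] to [B]. *)
Lemma disjoint_partner X' :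
  X' \in A -> X' `&` (Y `\ N) = fset0 -> X' = X.
Proof.
move=> XA' e; apply: stable_partner_uniq => //; apply/eqP.
have : X' `&` Y `<=` [fset N].
  apply/fsubsetP => z; rewrite !inE => /andP[zX zY].
  apply/contraT => zN; have /fsetP/(_ z) := e.
  by rewrite !inE zX zY zN.
by rewrite fsubset1 (negPf (AB XA' YB)) orbF.
Qed.

Lemma partner_notin : Y `\ N \notin B.
Proof.
apply/negP => YB'; have /negP := AB XA YB'; apply; apply/eqP/fsetP => z.
rewrite !inE; apply/negP => /and3P[zX zN zY].
by have /fsetP/(_ z) := XY; rewrite !inE zX zY (negPf zN).
Qed.

Lemma alteration : [/\ A `\ X `<=` G, (Y `\ N) |` B `<=` H,
    cross_intersecting (A `\ X) ((Y `\ N) |` B),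
    (mass (A `\ X) + mass ((Y `\ N) |` B) < mass A + mass B)%N
  & weight g (A `\ X) = weight g A - g X /\
    weight h B + 2 * h Y <= weight h ((Y `\ N) |` B)].
Proof.
have YH := fsubsetP BH _ YB.
split.
- exact: fsubset_trans (fsubsetDl _ _) AG.
- apply/fsubsetP => Z; rewrite !inE => /orP[/eqP ->|]; last exact: fsubsetP.
  exact: (wc_her Hh YH (fsubsetDl _ _)).
- move=> X' Z; rewrite !inE => /andP[XX' XA'] /orP[/eqP ->|]; last exact: AB.
  by apply: contraNneq XX' => /disjoint_partner ->.
- rewrite /mass [X in (_ < X + _)%N](big_fsetD1 X) //=.
  rewrite big_fsetU1 ?partner_notin //= addnCA -addnA ltn_add2r.
  (* The added set lies in [1, N - 1], so its code is below [2 ^ N], while the removed set [X]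
     contains [N] and has code at least [2 ^ N]. *)
  have : (code (Y `\ N) < 2 ^ N.-1.+1)%N.
    apply: code_lt; apply/fsubsetP => z; rewrite in_fsetD1 => /andP[zN zY].
    have /andP[z0 zleN] := wc_segment Hh YH zY.
    rewrite mem_segment z0 -ltnS (ltn_predK (leq_trans z0 zleN)).
    by rewrite ltn_neqAle zN.
  have N0 : (0 < N)%N by have := wc_segment Hh YH NY; lia.
  rewrite prednK // => /leq_trans; apply.
  by rewrite /code (big_fsetD1 N) //= leq_addr.
split.
  by rewrite /weight [X in _ = X - _](big_fsetD1 X) //= addrAC subrr add0r.
rewrite [X in _ <= X]/weight big_fsetU1 ?partner_notin //= addrC lerD //.
exact: (wc_double Hh YH NY).
Qed.

End OneSide.

(** The two gains are [2ay - bx - 2xy] and [2bx - ay - 2xy]. The first plus twice the second is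
    [3x(b - 2y)], which is positive as [b >= 3y], so one of them is positive. *)
Lemma alteration_gain (a b x y : R) : 0 < x -> x <= a -> 0 < y -> 3 * y <= b ->
  a * b < (a - x) * (b + 2 * y) \/ a * b < (a + 2 * x) * (b - y).
Proof.
move=> x0 xa y0 yb.
case: (ltP (a * b) ((a + 2 * x) * (b - y))) => [|le]; [by right | left].
nra.
Qed.

Variables (G H : setfam) (g h : {fset nat} -> R).
Hypotheses (Gg : weighted_complex N G g) (Hh : weighted_complex N H h).
Variables (A B : setfam).
Hypotheses (AG : A `<=` G) (BH : B `<=` H) (AB : cross_intersecting A B).
Hypothesis stA : forall i j X, (0 < i < j)%N -> X \in A -> delta i j X \in A.
Hypothesis stB : forall i j X, (0 < i < j)%N -> X \in B -> delta i j X \in B.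

(** Since [1] is not in [Y], it can replace [N] or another element [z] of [Y]. This gives three
    distinct sets of [B] of weight at least [h Y], whence the factor 3 that [alteration_gain] asks
    for. The case where [Y] is the singleton of [N] is treated apart. *)
Lemma improve (X Y : {fset nat}) : (1 < N)%N ->
    X \in A -> Y \in B -> X `&` Y = [fset N] -> 1%N \notin Y ->
  exists A' B' : setfam, [/\ A' `<=` G, B' `<=` H, cross_intersecting A' B',
    (mass A' + mass B' < mass A + mass B)%N
  & weight g A * weight h B < weight g A' * weight h B'].
Proof.
move=> N1 XA YB XY Y1.
have BA := cross_intersecting_sym AB.
have YX : Y `&` X = [fset N] by rewrite fsetIC.
have [dG dH dAB dm [dg dh]] := alteration Gg Hh AG BH AB stA XA YB XY.
have [eH eG eBA em [eh eg]] := alteration Hh Gg BH AG BA stB YB XA YX.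
have A0 T : T \in A -> 0 < g T by exact: (wc_gt0 Gg AG).
have B0 T : T \in B -> 0 < h T by exact: (wc_gt0 Hh BH).
have X0 := A0 _ XA; have Y0 := B0 _ YB.
have NY : N \in Y by have /fsetP/(_ N) := XY; rewrite !inE eqxx => /andP[].
suff [gain|gain] : weight g A * weight h B <
      (weight g A - g X) * (weight h B + 2 * h Y) \/
    weight g A * weight h B < (weight g A + 2 * g X) * (weight h B - h Y).
- exists (A `\ X), ((Y `\ N) |` B); split=> //.
  by rewrite (lt_le_trans gain) // dg ler_wpM2l // subr_ge0 weight_ge_mem.
- exists ((X `\ N) |` A), (B `\ Y); split=> //.
  + exact: (cross_intersecting_sym eBA).
  + by rewrite addnC [X in (_ < X)%N]addnC.
  + by rewrite (lt_le_trans gain) // eh ler_wpM2r // subr_ge0 weight_ge_mem.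
have gX := weight_ge_mem A0 XA.
have oneN : (0 < 1 < N)%N by [].
have leY i j : (0 < i < j)%N -> h Y <= h (delta i j Y).
  by move=> ij; apply: (wc_delta_weight Hh ij (fsubsetP BH _ YB)).
have d1N : (1%N \in delta 1 N Y) && (N \notin delta 1 N Y).
  by rewrite !in_delta NY Y1 !eqxx /= orbT gtn_eqF.
have YdN : delta 1 N Y != Y.
  by apply: contraNneq Y1 => {1}<-; case/andP: d1N.
have [Y'|/fset0Pn[z]] := eqVneq (Y `\ N) fset0.
  have YN : Y = [fset N] by rewrite -(fsetD1K NY) Y' fsetU0.
  (* Every set of [A] meets [Y] exactly in [N], hence is the partner of [Y]. *)
  have AX : A = [fset X].
    apply/eqP; rewrite eqEfsubset fsub1set XA andbT; apply/fsubsetP => X' XA'.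
    rewrite inE; apply/eqP.
    apply: (stable_partner_uniq Gg AG AB stA XA YB XY XA').
    apply/eqP; rewrite eqEfsubset {1}YN fsubsetIr fsub1set inE NY andbT.
    have /fset0Pn[z] := AB XA' YB; rewrite YN !inE => /andP[zX /eqP <-].
    exact: zX.
  (* Adding to [A] at least triples its weight, and [B] keeps at least half of its own because it
     also contains [delta 1 N Y]. *)
  right; have gA : weight g A = g X by rewrite AX /weight big_seq_fset1.
  have hB := weight_fset2_le B0 YB (stB oneN YB) YdN.
  have leN := leY _ _ oneN; rewrite gA.
  have : 0 < g X * (2 * weight h B - 3 * h Y) by rewrite mulr_gt0 //; lra.
  lra.
rewrite in_fsetD1 => /andP[zN zY].
have z1 : z != 1%N by apply: contraNneq Y1 => <-.
have /andP[z0 _] := wc_segment Hh (fsubsetP BH _ YB) zY.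
have onez : (0 < 1 < z)%N by rewrite /= ltn_neqAle eq_sym z1.
have dz : [&& 1%N \in delta 1 z Y, N \in delta 1 z Y & z \notin delta 1 z Y].
  by rewrite !in_delta zY Y1 NY !eqxx /= orbT (negPf z1) eq_sym zN.
(* Membership of [N] and of [z] tells the three sets apart. *)
have u : uniq [:: Y; delta 1 N Y; delta 1 z Y].
  rewrite /= !inE negb_or eq_sym YdN andbT.
  case/and3P: dz => dz1 dzN dzz; case/andP: d1N => dN1 dNN.
  apply/andP; split.
    by apply: contraNneq dzz => <-.
  by apply: contraNneq dNN => ->.
have := weight_fset3_le B0 YB (stB oneN YB) (stB onez YB) u.
have := leY _ _ oneN; have := leY _ _ onez => le1 le2 le3.
apply: alteration_gain => //; lra.
Qed.

End Alteration.

(** * Deleting the largest element *)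

Section Projection.
Variables (R : realType) (N : nat) (G : setfam) (g : {fset nat} -> R).
Hypotheses (Gg : weighted_complex N.+1 G g) (N0 : (0 < N)%N).
Implicit Types (A S : setfam) (X Y : {fset nat}).

Definition proj_complex : setfam := [fset X in G | N.+1 \notin X].

(** For [Y] in [proj_complex] this is the total weight of the sets of [G] that become [Y] once
    [N.+1] is deleted; the default 0 stands for an absent set. *)
Definition proj_weight (Y : {fset nat}) : R :=
  g Y + (if N.+1 |` Y \in G then g (N.+1 |` Y) else 0).

Lemma in_proj_complex X : (X \in proj_complex) = (X \in G) && (N.+1 \notin X).
Proof. by rewrite !inE. Qed.

Lemma delta_fsetU1 i j k X : k != i -> k != j ->
  delta i j (k |` X) = k |` delta i j X.
Proof.
move=> ki kj; rewrite /delta !in_fset1U ![_ == k]eq_sym (negPf ki) (negPf kj) /=.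
case: ifP => // _; apply/fsetP => z; rewrite !inE.
by have [->|] := eqVneq z k; rewrite ?kj.
Qed.

(** Both weight conditions hold summand by summand: if [Y] with [N.+1] added is in [G], heredity
    gives the same for the subsets of [Y], and shifts within [1, N] commute with adding [N.+1]. *)
Lemma proj_wc : weighted_complex N proj_complex proj_weight.
Proof.
have [GN her com [g0 ga gb] G1] := Gg.
have w0 Y : 0 <= if N.+1 |` Y \in G then g (N.+1 |` Y) else 0.
  by case: ifP => // /g0/ltW.
split.
- apply/fsubsetP => X; rewrite in_proj_complex fpowersetE => /andP[XG NX].
  apply/fsubsetP => z zX; have /andP[z0 zN] := wc_segment Gg XG zX.
  rewrite mem_segment z0 -ltnS ltn_neqAle zN andbT.
  by apply: contraNneq NX => <-.
- move=> X Y; rewrite !in_proj_complex => /andP[YG NY] XY.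
  rewrite (her _ _ YG XY); apply: contraNN NY; exact: (fsubsetP XY).
- move=> i j X ij; rewrite !in_proj_complex => /andP[XG NX] jX.
  rewrite in_fsetD mem_segment => /andP[iX /andP[i0 iN]].
  rewrite com //; last by rewrite in_fsetD iX mem_segment i0 leqW.
  by rewrite !inE (negPf NX) andbF gtn_eqF.
- split.
  + move=> X; rewrite in_proj_complex => /andP[XG _].
    by rewrite ltr_wpDr ?g0.
  + move=> X Y; rewrite !in_proj_complex => /andP[XG NX] /andP[YG NY] XY.
    rewrite /proj_weight mulrDr lerD ?ga //.
    case: ifPn => NYG; last by rewrite mulr0.
    have NXG : N.+1 |` X \in G.
      by apply: her NYG _; apply: fsetUS; exact: fproper_sub.
    rewrite NXG ga // fproperE; apply/andP; split.
      by apply: fsetUS; exact: fproper_sub.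
    move: XY; rewrite fproperE => /andP[_]; apply: contraNN => /fsubsetP YX.
    apply/fsubsetP => z zY; have : z \in N.+1 |` X by rewrite YX // !inE zY orbT.
    rewrite !inE => /orP[/eqP zN|//].
    by rewrite -zN zY in NY.
  + move=> X i j; rewrite in_proj_complex => /andP[XG NX].
    rewrite !mem_segment => /andP[i0 iN] /andP[_ jN] ij.
    have ij' : (0 < i < j)%N by rewrite i0.
    rewrite /proj_weight lerD ?(wc_delta_weight Gg) //.
    case: ifPn => [NXG|//]; rewrite -delta_fsetU1 ?gtn_eqF //.
    by rewrite (wc_delta Gg) // (wc_delta_weight Gg).
(* Here [N0] ensures that [1] is not the deleted element. *)
- by rewrite in_proj_complex G1 inE; apply/eqP; lia.
Qed.

(** The preimage of [S] under deletion splits into [S] itself and the sets containing [N.+1], which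
    correspond to the members of [S] whose extension by [N.+1] is in [G]. *)
Lemma weight_lift S : S `<=` proj_complex ->
  weight g [fset X in G | X `\ N.+1 \in S] = weight proj_weight S.
Proof.
move=> /fsubsetP SG.
have SN Y : Y \in S -> N.+1 \notin Y.
  by move/SG; rewrite in_proj_complex => /andP[].
rewrite /weight /proj_weight big_split /= -big_mkcond.
rewrite [X in _ = _ + X]big_fset_condE /=.
rewrite (big_fsetID _ (fun X => N.+1 \notin X)) /=; congr (_ + _).
  congr (\sum_(X <- enum_fset _) _); apply/fsetP => X; rewrite !inE /=.
  apply/idP/idP => [/andP[/andP[_ XS] NX]|XS].
    by rewrite mem_fsetD1 in XS.
  have := SG _ XS; rewrite in_proj_complex => /andP[-> NX].
  by rewrite mem_fsetD1 // XS.
set U := (X in \sum_(i <- enum_fset X) _ = _).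
have -> : U = [fset N.+1 |` Y | Y in [fset Y in S | N.+1 |` Y \in G]].
  apply/fsetP => X; rewrite !inE /= negbK.
  apply/idP/imfsetP => [/andP[/andP[XG XS] NX]|[Y /=]].
    by exists (X `\ N.+1); rewrite ?inE /= fsetD1K // XS.
  by rewrite !inE => /andP[YS YG] ->; rewrite YG fsetU1K ?SN // YS fset1U1.
rewrite big_imfset //= => X Y.
rewrite !inE => /andP[/SN NX _] /andP[/SN NY _] e.
by rewrite -(fsetU1K NX) e fsetU1K.
Qed.

Definition proj_family A : setfam := [fset X `\ N.+1 | X in A].

Lemma proj_family_sub A : A `<=` G -> proj_family A `<=` proj_complex.
Proof.
move=> /fsubsetP AG; apply/fsubsetP => _ /imfsetP[X /= /AG XG ->].
by rewrite in_proj_complex (wc_her Gg XG (fsubsetDl _ _)) fsetD11.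
Qed.

(** [A] is contained in the preimage of its projection. *)
Lemma weight_proj_family A : A `<=` G ->
  weight g A <= weight proj_weight (proj_family A).
Proof.
move=> AG; rewrite -weight_lift ?proj_family_sub //.
have sub : [fset X in G | X `\ N.+1 \in proj_family A] `<=` G.
  by apply/fsubsetP => X; rewrite !inE => /andP[].
apply: le_weight => [|X]; last exact: (wc_gt0 Gg sub).
apply/fsubsetP => X XA; rewrite !inE /= (fsubsetP AG) //=.
by apply/imfsetP; exists X.
Qed.

(** As [1] is not deleted, the star of [1] is the full preimage of its projection; so the bound for
    the projections is the bound for the original families. *)
Lemma weight_proj_star1 :
  weight proj_weight (star proj_complex 1%N) = weight g (star G 1%N).
Proof.
rewrite -weight_lift ?star_sub //; congr (weight g _).
have N1 : (1%N == N.+1) = false by apply/eqP; lia.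
apply/fsetP => X; rewrite !inE /= N1 eqxx /=.
have [XG /=|//] := boolP (X \in G).
by rewrite (wc_her Gg XG (fsubsetDl _ _)).
Qed.

End Projection.

Lemma cross_proj (N : nat) (A B : setfam) : cross_intersecting A B ->
    (forall X Y, X \in A -> Y \in B -> X `&` Y != [fset N.+1]) ->
  cross_intersecting (proj_family N A) (proj_family N B).
Proof.
move=> AB nN _ _ /imfsetP[X /= XA ->] /imfsetP[Y /= YB ->].
apply: contraNneq (nN _ _ XA YB) => e.
have : X `&` Y `<=` [fset N.+1].
  apply/fsubsetP => z; rewrite !inE => /andP[zX zY].
  by apply/contraT => zN; have /fsetP/(_ z) := e; rewrite !inE zX zY zN.
by rewrite fsubset1 (negPf (AB _ _ XA YB)) orbF.
Qed.

(** * The bound, by nested induction *)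

(** Equality is recorded only through a common singleton: this weak form can be pulled back through
    shifts, whereas being a star is recovered from it at the end by [substar_eq]. *)
Definition star_bound (R : realType) (G H : setfam) (g h : {fset nat} -> R)
    (A B : setfam) : Prop :=
  weight g A * weight h B <= weight g (star G 1%N) * weight h (star H 1%N) /\
  (weight g A * weight h B = weight g (star G 1%N) * weight h (star H 1%N) ->
   exists x, [fset x] \in A /\ [fset x] \in B).

Section Steps.
Variables (R : realType) (N : nat) (G H : setfam) (g h : {fset nat} -> R).
Hypotheses (Gg : weighted_complex N G g) (Hh : weighted_complex N H h).
Variables (A B : setfam).
Hypotheses (AG : A `<=` G) (BH : B `<=` H) (AB : cross_intersecting A B).

Lemma star_bound_shift i j : (0 < i < j)%N ->
  star_bound G H g h (shift i j A) (shift i j B) -> star_bound G H g h A B.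
Proof.
move=> ij [le1 eq1].
have lt : weight g A * weight h B <=
    weight g (shift i j A) * weight h (shift i j B).
  rewrite ler_pM //; try (by apply: weight_ge0 => X; apply: wc_gt0; eassumption).
  - exact: (wc_shift_weight Gg).
  - exact: (wc_shift_weight Hh).
split; first exact: le_trans le1.
move=> e; case: eq1 => [|a [/shift_set1[x xA] /shift_set1[y yB]]].
  by apply/eqP; rewrite eq_le le1 -e.
(* The singletons pulled back to [A] and [B] might differ; cross-intersection identifies them. *)
have /fset0Pn[z] := AB xA yB; rewrite !inE => /andP[/eqP zx /eqP zy].
by exists z; split; [rewrite zx | rewrite zy].
Qed.

Lemma star_bound_lt (A' B' : setfam) : star_bound G H g h A' B' ->
  weight g A * weight h B < weight g A' * weight h B' -> star_bound G H g h A B.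
Proof.
move=> [le1 _] lt; have lt' := lt_le_trans lt le1; split; first exact: ltW.
by move=> e; rewrite e ltxx in lt'.
Qed.

Lemma star_bound_nil : A = fset0 \/ B = fset0 -> star_bound G H g h A B.
Proof.
move=> AB0; rewrite /star_bound.
have -> : weight g A * weight h B = 0.
  by case: AB0 => ->; rewrite /weight big_seq_fset0 ?mul0r ?mulr0.
have M0 : 0 < weight g (star G 1%N) * weight h (star H 1%N).
  by rewrite mulr_gt0 // (weight_star1_gt0 Gg, weight_star1_gt0 Hh).
by split; [exact: ltW | move=> e; rewrite -e ltxx in M0].
Qed.

End Steps.

Lemma star_bound1 (R : realType) (G H : setfam) (g h : {fset nat} -> R)
    (A B : setfam) :
    weighted_complex 1 G g -> weighted_complex 1 H h ->
    A `<=` G -> B `<=` H -> cross_intersecting A B ->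
  star_bound G H g h A B.
Proof.
move=> Gg Hh AG BH AB.
have [A0|/fset0Pn[X0 XA0]] := eqVneq A fset0.
  by apply: (star_bound_nil Gg Hh); left.
have [B0|/fset0Pn[Y0 YB0]] := eqVneq B fset0.
  by apply: (star_bound_nil Gg Hh); right.
have AB1 X Y : X \in A -> Y \in B -> X = [fset 1%N] /\ Y = [fset 1%N].
  move=> XA YB; have seg1 (F : setfam) (f : {fset nat} -> R) Z :
      weighted_complex 1 F f -> Z \in F -> Z `<=` [fset 1%N].
    move=> Ff ZF; apply/fsubsetP => z zZ; rewrite inE.
    by have := wc_segment Ff ZF zZ; rewrite andbC -eqn_leq.
  have /fset0Pn[z] := AB _ _ XA YB; rewrite inE => /andP[zX zY].
  have := seg1 _ _ _ Gg (fsubsetP AG _ XA); rewrite fsubset1.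
  have := seg1 _ _ _ Hh (fsubsetP BH _ YB); rewrite fsubset1.
  by case/orP => /eqP eY /orP[]/eqP eX; move: zX zY; rewrite eX eY.
split; last first.
  by move=> _; exists 1%N; have [e1 e2] := AB1 _ _ XA0 YB0; rewrite -{1}e1 -e2.
apply: ler_pM.
- by apply: weight_ge0 => X; exact: (wc_gt0 Gg).
- by apply: weight_ge0 => X; exact: (wc_gt0 Hh).
- apply: le_weight => [|X]; last exact: (wc_gt0 Gg (star_sub _ _)).
  apply/fsubsetP => X XA; rewrite in_star (fsubsetP AG) //=.
  by have [-> _] := AB1 _ _ XA YB0; rewrite inE.
- apply: le_weight => [|X]; last exact: (wc_gt0 Hh (star_sub _ _)).
  apply/fsubsetP => X XB; rewrite in_star (fsubsetP BH) //=.
  by have [_ ->] := AB1 _ _ XA0 XB; rewrite inE.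
Qed.

Lemma star_bound_all (R : realType) (N : nat) (G H : setfam)
    (g h : {fset nat} -> R) (A B : setfam) :
    weighted_complex N G g -> weighted_complex N H h ->
    A `<=` G -> B `<=` H -> cross_intersecting A B ->
  star_bound G H g h A B.
Proof.
elim: N G H g h A B => [|N IHN] G H g h A B Gg Hh.
  (* There is no complex for [N = 0], as the singleton of [1] does not fit in an empty ground
     set. *)
  by have := wc_segment Gg (wc_in1 Gg) (fset11 1%N).
case: N => [|N] in IHN Gg Hh *; first exact: star_bound1.
(* Inner induction on the total mass, the complexes being fixed; it covers shifts and trades, while
   the outer one covers projection. *)
have [k] := ubnP (mass A + mass B); elim: k A B => // k IHk A B.
rewrite ltnS => massk AG BH AB.
have [[i [j [ij mv]]]|stable] := EM (exists i j, (0 < i < j)%N /\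
    ((exists2 X, X \in A & delta i j X \notin A) \/
     (exists2 X, X \in B & delta i j X \notin B))).
  have /andP[i0 ltij] := ij; have neij : i != j by rewrite ltn_eqF.
  apply: (star_bound_shift Gg Hh AG BH AB ij); apply: IHk.
  - apply: leq_trans massk.
    case: mv => -[X XA dX].
      rewrite -addSn; apply: leq_add; last exact: mass_shift.
      exact: mass_shift_lt dX.
    rewrite -addnS; apply: leq_add; first exact: mass_shift.
    exact: mass_shift_lt dX.
  - exact: (wc_shift_sub Gg).
  - exact: (wc_shift_sub Hh).
  - exact: shift_cross.
have stA i j X : (0 < i < j)%N -> X \in A -> delta i j X \in A.
  move=> ij XA; apply/contraT => dX; case: stable; exists i, j.
  by split=> //; left; exists X.
have stB i j X : (0 < i < j)%N -> X \in B -> delta i j X \in B.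
  move=> ij XB; apply/contraT => dX; case: stable; exists i, j.
  by split=> //; right; exists X.
have [[X [Y [XA YB XY]]]|noN] :=
  EM (exists X Y, [/\ X \in A, Y \in B & X `&` Y = [fset N.+2]]).
  (* [X] and [Y] share only [N.+2], so [1] is missing from one of them, and [improve] applies up to
     exchanging the two sides. *)
  have [Y1|Y1] := boolP (1%N \in Y).
    have X1 : 1%N \notin X.
      by apply/negP => X1; have /fsetP/(_ 1%N) := XY; rewrite !inE X1 Y1.
    have BA := cross_intersecting_sym AB.
    rewrite fsetIC in XY.
    have [B' [A' [BH' AG' BA' lt gain]]] :=
      improve Hh Gg BH AG BA stB stA isT YB XA XY X1.
    apply: (@star_bound_lt _ _ _ _ _ _ _ A' B'); last first.
      by rewrite mulrC [X in _ < X]mulrC.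
    apply: IHk => //; last exact: (cross_intersecting_sym BA').
    by rewrite addnC (leq_trans lt) // addnC.
  have [A' [B' [AG' BH' AB' lt gain]]] :=
    improve Gg Hh AG BH AB stA stB isT XA YB XY Y1.
  apply: (star_bound_lt _ gain); apply: IHk => //.
  exact: leq_trans massk.
have AB0 : cross_intersecting (proj_family N.+1 A) (proj_family N.+1 B).
  apply: cross_proj => // X Y XA YB; apply/eqP => XY.
  by apply: noN; exists X, Y.
have Gp := proj_wc Gg isT; have Hp := proj_wc Hh isT.
have Ap := proj_family_sub Gg AG; have Bp := proj_family_sub Hh BH.
have [] := IHN _ _ _ _ _ _ Gp Hp Ap Bp AB0.
rewrite !weight_proj_star1 // => le1 eq1.
have leA := weight_proj_family Gg AG; have leB := weight_proj_family Hh BH.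
have le0 : weight g A * weight h B <=
    weight (proj_weight N.+1 G g) (proj_family N.+1 A) *
    weight (proj_weight N.+1 H h) (proj_family N.+1 B).
  apply: ler_pM => //; apply: weight_ge0 => X; first exact: (wc_gt0 Gg).
  exact: (wc_gt0 Hh).
split; first exact: le_trans le1.
move=> e; case: eq1 => [|x [xA xB]]; first by apply/eqP; rewrite eq_le le1 -e.
have /andP[x0 _] := wc_segment Gp (fsubsetP Ap _ xA) (fset11 x).
(* The singleton of [x] lies in both projections, which cross-intersect; so every set of [A] and of
   [B] contains [x]. *)
have meet1 X : [fset x] `&` (X `\ N.+2) != fset0 -> x \in X.
  by case/fset0Pn => z; rewrite !inE => /and3P[/eqP -> _].
have Ax : A `<=` star G x.
  apply/fsubsetP => X XA; rewrite in_star (fsubsetP AG) //=; apply: meet1.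
  by rewrite fsetIC; apply: AB0 => //; apply/imfsetP; exists X.
have Bx : B `<=` star H x.
  apply/fsubsetP => X XB; rewrite in_star (fsubsetP BH) //=; apply: meet1.
  by apply: AB0 => //; apply/imfsetP; exists X.
(* A priori the projected singleton might come from a set that also contains [N.+2]. Equality makes
   [A] and [B] full stars, and these do contain the singleton of [x]. *)
have [-> -> _ _] := substar_eq Gg Hh x0 Ax Bx e.
move/(fsubsetP Ap): xA; move/(fsubsetP Bp): xB.
rewrite !in_proj_complex => /andP[xH _] /andP[xG _].
by exists x; rewrite !in_star xG xH inE eqxx.
Qed.

(** * Reduction to weighted complexes and degenerate cases *)

(** Passing from [m] to [N] preserves compression because every [j] in a set of [G] is at most [m].
    Heredity provides some singleton in [G], which compression moves to that of [1]. *)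
Lemma weighted_complexW (R : realType) (m N : nat) (G : setfam)
    (g : {fset nat} -> R) : (m <= N)%N ->
    G != fset0 -> G != [fset fset0] -> G `<=` fpowerset (segment m) ->
    hereditary G -> compressed m G -> admissible N G g ->
  weighted_complex N G g.
Proof.
move=> mN G0 G00 /fsubsetP Gm her com adm.
have seg X z : X \in G -> z \in X -> (0 < z <= m)%N.
  by move/Gm; rewrite fpowersetE => /fsubsetP XN /XN; rewrite mem_segment.
split=> //.
- apply/fsubsetP => X XG; rewrite fpowersetE; apply/fsubsetP => z zX.
  have /andP[z0 zm] := seg _ _ XG zX.
  by rewrite mem_segment z0 (leq_trans zm mN).
- move=> i j X ij XG jX; rewrite in_fsetD => /andP[iX _]; apply: com => //.
  have /andP[_ jm] := seg _ _ XG jX; have /andP[i0 lij] := ij.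
  by rewrite in_fsetD iX mem_segment i0 (leq_trans (ltnW lij)).
have [X XG X0] : exists2 X, X \in G & X != fset0.
  apply: contrapT => none; have : G `<=` [fset fset0].
    apply/fsubsetP => X XG; rewrite inE; apply/contraT => X0.
    by case: none; exists X.
  by rewrite fsubset1 (negPf G0) (negPf G00).
have /fset0Pn[x xX] := X0.
have xG : [fset x] \in G by apply: her XG _; rewrite fsub1set.
have /andP[x0 xm] := seg _ _ XG xX.
have [<-//|x1] := eqVneq x 1%N.
have -> : [fset 1%N] = ([fset x] `\ x) `|` [fset 1%N] by rewrite fsetDv fset0U.
apply: com (xG) _ _; rewrite ?inE ?eqxx //.
  by rewrite /= ltn_neqAle eq_sym x1.
by rewrite eq_sym x1 mem_iota /= ltnS (leq_trans x0 xm).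
Qed.

(** The empty set meets nothing, so one of the two families must be empty. *)
Lemma weight_cross_trivial (R : realType) (g h : {fset nat} -> R)
    (A B : setfam) :
  A `<=` [fset fset0] -> cross_intersecting A B -> weight g A * weight h B = 0.
Proof.
move=> A0 AB.
have [->|[X XA]] := fset_0Vmem A; first by rewrite /weight big_seq_fset0 mul0r.
have [->|[Y YB]] := fset_0Vmem B; first by rewrite /weight big_seq_fset0 mulr0.
have := AB _ _ XA YB; have := fsubsetP A0 _ XA; rewrite inE => /eqP ->.
by rewrite fset0I eqxx.
Qed.

Lemma weight_star_trivial (R : realType) (g : {fset nat} -> R) x :
  weight g (star [fset fset0] x) = 0.
Proof.
rewrite /weight big1_fset // => X; rewrite in_star !inE.
by case/andP => /eqP ->; rewrite inE.
Qed.

(** The last clause sets aside complexes whose only member is the empty set: if [G] is such, then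
    [A = G] and empty [B] give equality, both products being 0, although [A] is not a star. *)
Theorem theorem3p1 (R : realType) (m n : nat) (G H : {fset {fset nat}})
    (g h : {fset nat} -> R)
    (G0 : G != fset0) (Gm : G `<=` fpowerset (segment m))
    (H0 : H != fset0) (Hn : H `<=` fpowerset (segment n))
    (Gher : hereditary G) (Gcom : compressed m G)
    (Hher : hereditary H) (Hcom : compressed n H)
    (gadm : admissible (maxn m n) G g) (hadm : admissible (maxn m n) H h)
    (A B : {fset {fset nat}})
    (AG : A `<=` G) (BH : B `<=` H) (AB : cross_intersecting A B) :
  let extremal := exists a : nat,
    [/\ a \in segment m `&` segment n, A = star G a, B = star H a,
        weight g (star G a) = weight g (star G 1%N)
      & weight h (star H a) = weight h (star H 1%N)] in
  let equality :=
    weight g A * weight h B = weight g (star G 1%N) * weight h (star H 1%N) in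
  [/\ weight g A * weight h B <= weight g (star G 1%N) * weight h (star H 1%N),
      extremal -> equality
    & G != [fset fset0] -> H != [fset fset0] -> equality -> extremal].
Proof.
move=> extremal equality.
have ext_eq : extremal -> equality.
  by case=> a [_ eA eB eg eh]; rewrite /equality eA eB eg eh.
have [G00|G00] := eqVneq G [fset fset0].
  rewrite G00 in AG *; split=> //.
  by rewrite (weight_cross_trivial g h AG AB) weight_star_trivial mul0r.
have [H00|H00] := eqVneq H [fset fset0].
  rewrite H00 in BH *; split=> //.
  have BA := cross_intersecting_sym AB.
  by rewrite mulrC (weight_cross_trivial h g BH BA) weight_star_trivial mulr0.
have Gg := weighted_complexW (leq_maxl m n) G0 G00 Gm Gher Gcom gadm.
have Hh := weighted_complexW (leq_maxr m n) H0 H00 Hn Hher Hcom hadm.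
have [le1 eq1] := star_bound_all Gg Hh AG BH AB.
split=> // _ _ e; have [a [aA aB]] := eq1 e; exists a.
have aG := fsubsetP AG _ aA; have aH := fsubsetP BH _ aB.
have am : a \in segment m.
  by move/(fsubsetP Gm): aG; rewrite fpowersetE fsub1set.
have an : a \in segment n.
  by move/(fsubsetP Hn): aH; rewrite fpowersetE fsub1set.
have a0 : (0 < a)%N by move: am; rewrite mem_segment => /andP[].
have Aa : A `<=` star G a.
  apply/fsubsetP => X XA; rewrite in_star (fsubsetP AG) //=.
  by have /fset0Pn[z] := AB _ _ XA aB; rewrite !inE => /andP[zX /eqP <-].
have Ba : B `<=` star H a.
  apply/fsubsetP => X XB; rewrite in_star (fsubsetP BH) //=.
  by have /fset0Pn[z] := AB _ _ aA XB; rewrite !inE => /andP[/eqP <-].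
have [eA eB eg eh] := substar_eq Gg Hh a0 Aa Ba e.
by split; rewrite // in_fsetI am an.
Qed.
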